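(* Let $Q_{4p}=\langle a,b: a^{2p}=1, b^2=a^p, bab^{-1}=a^{-1}\rangle$ be the dicyclic group of order $4p$, where $p$ is a prime. Then \[ \mathcal{B}(Q_{4p})=\begin{cases} K_2\sqcup K_{1,3}\sqcup 3K_{1,12}\sqcup K_{1,24}, & \text{when } p=2,\\ K_2\sqcup K_{1,3}\sqcup pK_{1,12}\sqcup K_{1,p^2-1}\sqcup K_{1,3p^2-3}\sqcup K_{1,12p^2-12p}, & \text{when } p\geq 3. \end{cases} \]
   Context: For a group $G$, let $L(G)$ be the set of all subgroups of $G$. The graph $\mathcal{B}(G)$ is the simple undirected bipartite graph with vertex set the disjoint union $V(\mathcal{B}(G)) = (G\times G) \sqcup L(G)$, in which $(a,b)\in G\times G$ and $H \in L(G)$ are adjacent if and only if $H = \langle a,b\rangle$, and there are no other edges. $K_n$ is the complete graph on $n$ vertices, $K_{1,n}$ is the star on $n+1$ vertices, $\sqcup$ denotes disjoint union of graphs, and $mK_{1,n}$ denotes the disjoint union of $m$ copies of $K_{1,n}$. Equality of graphs means isomorphism. *)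

(* Defs.v *)
From HB Require Import structures.
From mathcomp Require Import all_boot all_fingroup.

Set Implicit Arguments.
Unset Strict Implicit.
Unset Printing Implicit Defensive.

Record sgraph := SGraph {
  vertex :> finType;
  adj : rel vertex;
  adj_sym : symmetric adj;
  adj_irrefl : irreflexive adj }.

Arguments adj {s} x y.

Definition graph_iso (X Y : sgraph) : Prop :=
  exists f : X -> Y,
    bijective f /\ forall x y : X, adj (f x) (f y) = adj x y.

Definition complete_adj (n : nat) : rel 'I_n := [rel i j | i != j].

Fact complete_sym n : symmetric (@complete_adj n).
Proof. by move=> i j; rewrite /complete_adj /= eq_sym. Qed.

Fact complete_irrefl n : irreflexive (@complete_adj n).
Proof. by move=> i; rewrite /complete_adj /= eqxx. Qed.

Definition complete_graph (n : nat) : sgraph :=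
  SGraph (@complete_sym n) (@complete_irrefl n).

(* The star K_{1,n}: the centre is None, the n leaves are the Some i. *)
Definition star_adj (n : nat) : rel (option 'I_n) :=
  [rel x y | isSome x != isSome y].

Fact star_sym n : symmetric (@star_adj n).
Proof. by case=> [i|] [j|]. Qed.

Fact star_irrefl n : irreflexive (@star_adj n).
Proof. by case. Qed.

Definition star (n : nat) : sgraph := SGraph (@star_sym n) (@star_irrefl n).

Definition disjoint_adj (X Y : sgraph) : rel (X + Y)%type :=
  fun u v => match u, v with
  | inl x, inl x' => adj x x'
  | inr y, inr y' => adj y y'
  | _, _ => false
  end.

Fact disjoint_sym X Y : symmetric (@disjoint_adj X Y).
Proof. by case=> [x|y] [x'|y'] //=; rewrite adj_sym. Qed.

Fact disjoint_irrefl X Y : irreflexive (@disjoint_adj X Y).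
Proof. by case=> [x|y] /=; rewrite adj_irrefl. Qed.

Definition disjoint_union (X Y : sgraph) : sgraph :=
  SGraph (@disjoint_sym X Y) (@disjoint_irrefl X Y).

Definition copies_adj (m : nat) (X : sgraph) : rel ('I_m * X)%type :=
  [rel u v | (u.1 == v.1) && adj u.2 v.2].

Fact copies_sym m X : symmetric (@copies_adj m X).
Proof. by move=> u v; rewrite /copies_adj /= adj_sym eq_sym. Qed.

Fact copies_irrefl m X : irreflexive (@copies_adj m X).
Proof. by move=> u; rewrite /copies_adj /= adj_irrefl andbF. Qed.

Definition copies (m : nat) (X : sgraph) : sgraph :=
  SGraph (@copies_sym m X) (@copies_irrefl m X).

Declare Scope sgraph_scope.
Delimit Scope sgraph_scope with sg.
Bind Scope sgraph_scope with sgraph.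

Notation "''K_' n" := (complete_graph n)
  (at level 8, n at level 2, format "''K_' n") : sgraph_scope.
Notation "''K_(1,' n )" := (star n)
  (at level 8, n at level 99, format "''K_(1,'  n )") : sgraph_scope.
Notation "X ⊔ Y" := (disjoint_union X Y)
  (at level 50, left associativity) : sgraph_scope.
Notation "m ⋅ X" := (copies m X)
  (at level 40, left associativity) : sgraph_scope.
Notation "X ≅ Y" := (graph_iso X%sg Y%sg)
  (at level 70, no associativity) : type_scope.

Section SubgroupGeneratingBipartiteGraph.

Variables (gT : finGroupType) (G : {group gT}).

Definition pair_vertex := {u : gT * gT | u \in setX G G}.

Definition subgroup_vertex := {H : {group gT} | H \in subgroups G}.

Definition generates (u : pair_vertex) (H : subgroup_vertex) : bool :=
  val H == <<[set (val u).1; (val u).2]>>%G.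

Definition sgb_adj : rel (pair_vertex + subgroup_vertex)%type :=
  fun v w => match v, w with
  | inl u, inr H => generates u H
  | inr H, inl u => generates u H
  | _, _ => false
  end.

Fact sgb_sym : symmetric sgb_adj.
Proof. by case=> [u|H] [u'|H']. Qed.

Fact sgb_irrefl : irreflexive sgb_adj.
Proof. by case. Qed.

Definition sgb_graph : sgraph := SGraph sgb_sym sgb_irrefl.

End SubgroupGeneratingBipartiteGraph.

Notation "''B' ( G )" := (sgb_graph G)
  (at level 8, format "''B' ( G )") : sgraph_scope.

(* Main.v *)
(* B(G) is a disjoint union of stars, one for each subgroup H, with as many
   leaves as there are pairs (x, y) generating H; a disjoint union of stars is
   determined up to isomorphism by its multiset of numbers of leaves. Sorting
   the pairs of H^2 by the subgroup they generate, these numbers g(K) satisfy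
   sum_(K <= H) g(K) = |H|^2. Writing A = <a>, of order 2p, every element x
   outside A satisfies x^2 = a^p, so the subgroups of Q are those of the cyclic
   group A, the p cyclic subgroups of order 4 generated by the elements outside
   A, and Q itself; the identity above then yields all the numbers g(K). *)
Require Import Defs.
From mathcomp Require Import all_boot all_fingroup all_solvable zify.

Set Implicit Arguments.
Unset Strict Implicit.
Unset Printing Implicit Defensive.

(** * Graph isomorphisms and disjoint unions of stars *)

Lemma perm_eq_bij (X Y : finType) (K : eqType) (k : X -> K) (l : Y -> K) :
    perm_eq [seq k x | x : X] [seq l y | y : Y] ->
  exists2 h : X -> Y, bijective h & forall x, l (h x) = k x.
Proof.
move=> kl; have eXY : #|X| = #|Y|.
  by rewrite -(size_image k) -(size_image l) (perm_size kl).
have sl : size [seq l y | y : Y] == #|X| by rewrite size_image eXY.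
have sk : size [seq k x | x : X] == #|X| by rewrite size_image.
have [s sE] : exists s : 'S_#|X|, [seq k x | x : X] =
    [tuple tnth (Tuple sl) (s i) | i < #|X|].
  exact/tuple_permP.
exists (enum_val \o cast_ord eXY \o s \o enum_rank).
  apply: bij_comp (enum_rank_bij X).
  apply: bij_comp (Bijective (permK s) (permKV s)).
  apply: bij_comp (enum_val_bij Y) _.
  exact: Bijective (cast_ordK _) (cast_ordKV _).
move=> x; have eT : Tuple sk = [tuple tnth (Tuple sl) (s i) | i < #|X|].
  exact: val_inj.
have := congr1 (fun t => tnth t (enum_rank x)) eT.
rewrite tnth_mktuple (tnth_nth (k x)) [RHS](tnth_nth (k x)) /=.
rewrite nth_image enum_rankK => ->.
by rewrite -[nat_of_ord (s _)]/(nat_of_ord (cast_ord eXY (s (enum_rank x)))) nth_image.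
Qed.

Lemma graph_iso_sym (X Y : sgraph) : X ≅ Y -> Y ≅ X.
Proof.
case=> f [[g fK gK] f_adj]; exists g; split; first by exists f.
by move=> x y; rewrite -f_adj !gK.
Qed.

Lemma graph_iso_trans (X Y Z : sgraph) : X ≅ Y -> Y ≅ Z -> X ≅ Z.
Proof.
case=> f [f_bij f_adj] [g [g_bij g_adj]]; exists (g \o f).
by split=> [|x y /=]; [apply: bij_comp | rewrite g_adj f_adj].
Qed.

Section FibreGraph.

Variables (A B : finType) (f : A -> B).

(** Each [a] has [f a] as its only neighbour, so the components are stars centred at the points of
    [B]. *)
Definition fibre_adj : rel (A + B)%type := fun v w =>
  match v, w with
  | inl a, inr b | inr b, inl a => f a == b
  | _, _ => false
  end.

Fact fibre_sym : symmetric fibre_adj.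
Proof. by case=> [a|b] [a'|b']. Qed.

Fact fibre_irrefl : irreflexive fibre_adj.
Proof. by case. Qed.

Definition fibre_graph : sgraph := SGraph fibre_sym fibre_irrefl.

Definition fibre_size (b : B) : nat := #|[set a | f a == b]|.

End FibreGraph.

Lemma count_mem_image (A B : finType) (f : A -> B) b :
  count_mem b [seq f a | a : A] = fibre_size f b.
Proof.
rewrite count_map /fibre_size cardE [in RHS]/enum_mem size_filter -enumT.
by apply: eq_count => a; rewrite /= inE.
Qed.

(** Centres are matched first, by fibre size, then leaves over matched centres; both matchings come
    from [perm_eq_bij]. *)
Lemma fibre_graph_iso (A B A' B' : finType) (f : A -> B) (f' : A' -> B') :
    perm_eq [seq fibre_size f b | b : B] [seq fibre_size f' b | b : B'] ->
  fibre_graph f ≅ fibre_graph f'.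
Proof.
case/perm_eq_bij=> h [h' hK h'K] hE.
have [|g [g' gK g'K] gE] := @perm_eq_bij _ _ _ (h \o f) f'.
  apply/allP => b' _ /=; rewrite !count_mem_image -[X in fibre_size f' X]h'K hE.
  by apply/eqP/eq_card => a; rewrite !inE /= (can2_eq hK h'K).
exists (fun v => match v with inl a => inl (g a) | inr b => inr (h b) end).
split=> [|[a|b] [a'|b'] //=]; try by rewrite gE (can_eq hK).
exists (fun v => match v with inl a => inl (g' a) | inr b => inr (h' b) end).
  by case=> [a|b]; rewrite ?gK ?hK.
by case=> [a|b]; rewrite ?g'K ?h'K.
Qed.

(* s lists the number of leaves of each star of X, a 0 being an isolated centre. *)
Definition star_forest (s : seq nat) (X : sgraph) : Prop :=
  exists (A B : finType) (f : A -> B),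
    fibre_graph f ≅ X /\ perm_eq [seq fibre_size f b | b : B] s.

Lemma star_forest_iso s t X Y :
  star_forest s X -> star_forest t Y -> perm_eq s t -> X ≅ Y.
Proof.
move=> [A [B [f [fX fs]]]] [A' [B' [f' [f'Y f't]]]] st.
apply: graph_iso_trans (graph_iso_sym fX) (graph_iso_trans _ f'Y).
by apply: fibre_graph_iso; rewrite (permPl fs) (permPr f't).
Qed.

Lemma enum_sumT (A B : finType) :
  enum {: A + B} = map inl (enum A) ++ map inr (enum B).
Proof.
by rewrite !enumT; have -> : Finite.enum _ = sum_enum A B by rewrite unlock.
Qed.

Lemma enum_prodT (A B : finType) :
  enum {: A * B} = [seq (a, b) | a <- enum A, b <- enum B].
Proof.
by rewrite [LHS]enumT; have -> : Finite.enum _ = prod_enum A B by rewrite unlock.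
Qed.

Lemma star_forest_star n : star_forest [:: n] 'K_(1, n)%sg.
Proof.
exists 'I_n, unit, (fun _ => tt); split.
  exists (fun v => match v with inl i => Some i | inr _ => None end).
  split; last by case=> [i|[]] [j|[]].
  exists (fun v => if v is Some i then inl i else inr tt); first by case=> [|[]].
  by case.
rewrite /image_mem enumT unlock /= perm_sym /fibre_size.
by rewrite (_ : [set _ | _] = setT) ?cardsT ?card_ord //; apply/setP=> i; rewrite !inE.
Qed.

Lemma star_forest_K2 : star_forest [:: 1] 'K_2%sg.
Proof.
exists unit, unit, id; split.
  exists (fun v => if v is inl _ then ord0 else ord_max).
  split; last by case=> [[]|[]] [[]|[]].
  apply: inj_card_bij; first by case=> [[]|[]] [[]|[]].
  by rewrite card_ord card_sum card_unit.
rewrite /image_mem enumT unlock /= perm_sym /fibre_size.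
by rewrite (_ : [set _ | _] = setT) ?cardsT ?card_unit //; apply/setP=> -[]; rewrite !inE.
Qed.

Lemma star_forest_disjoint_union s t X Y :
  star_forest s X -> star_forest t Y -> star_forest (s ++ t) (X ⊔ Y)%sg.
Proof.
move=> [A [B [f [[i [i_bij iE]] fs]]]] [C [D [g [[j [j_bij jE]] gt]]]].
pose fg (v : A + C) := match v with inl a => inl (f a) | inr c => inr (g c) end.
exists (A + C)%type, (B + D)%type, fg; split.
  exists (fun v => match v with
    | inl (inl a) => inl (i (inl a)) | inl (inr c) => inr (j (inl c))
    | inr (inl b) => inl (i (inr b)) | inr (inr d) => inr (j (inr d)) end).
  split; last by case=> [[a|c]|[b|d]] [[a'|c']|[b'|d']] //=; rewrite ?iE ?jE.
  apply: inj_card_bij.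
    by case=> [[a|c]|[b|d]] [[a'|c']|[b'|d']] //= [];
      (move/(bij_inj i_bij) || move/(bij_inj j_bij)) => // -[->].
  by rewrite !card_sum -(bij_eq_card i_bij) -(bij_eq_card j_bij) !card_sum addnACA.
have fgl b : fibre_size fg (inl b) = fibre_size f b.
  rewrite /fibre_size -(card_imset _ (@inl_inj A C)).
  apply: eq_card => -[a|c]; rewrite !inE; last by symmetry; apply/imsetP=> -[].
  by rewrite (mem_imset _ _ inl_inj) inE.
have fgr d : fibre_size fg (inr d) = fibre_size g d.
  rewrite /fibre_size -(card_imset _ (@inr_inj A C)).
  apply: eq_card => -[a|c]; rewrite !inE; first by symmetry; apply/imsetP=> -[].
  by rewrite (mem_imset _ _ inr_inj) inE.
rewrite /image_mem enum_sumT map_cat -(map_comp _ _ (enum B)) -(map_comp _ _ (enum D)).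
by rewrite (eq_map fgl) (eq_map fgr) perm_cat.
Qed.

Lemma star_forest_copies s X m :
  star_forest s X -> star_forest (flatten (nseq m s)) (m ⋅ X)%sg.
Proof.
move=> [A [B [f [[i [i_bij iE]] fs]]]].
pose fm (v : 'I_m * A) := (v.1, f v.2).
exists ('I_m * A)%type, ('I_m * B)%type, fm; split.
  exists (fun v => match v with
    | inl (k, a) => (k, i (inl a)) | inr (k, b) => (k, i (inr b)) end).
  split; last first.
    case=> [[k a]|[k b]] [[k' a']|[k' b']] //=; rewrite /copies_adj /= iE /= ?andbF //.
    by rewrite eq_sym.
  apply: inj_card_bij.
    by case=> [[k a]|[k b]] [[k' a']|[k' b']] //= [-> /(bij_inj i_bij)] // [->].
  by rewrite card_sum !card_prod -(bij_eq_card i_bij) card_sum mulnDr.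
rewrite /image_mem enum_prodT.
have fmE k b : fibre_size fm (k, b) = fibre_size f b.
  have pair_inj : injective (pair k : A -> _) by move=> a a' [].
  rewrite /fibre_size -(card_imset _ pair_inj); apply: eq_card => -[l a].
  rewrite !inE; apply/eqP/imsetP=> [[-> <-]|[a']]; first by exists a; rewrite ?inE.
  by rewrite inE => /eqP <- [-> ->].
(* The enumeration of the product has one block per element of [enum 'I_m]; writing [m] as the size
   of that list allows induction on it. *)
rewrite map_flatten -map_comp -[X in nseq X _](size_enum_ord m).
elim: (enum 'I_m) => //= k e IHe; apply: perm_cat => //.
by rewrite -(map_comp _ _ (enum B)) (eq_map (fmE k)).
Qed.

(** * Divisors of a prime and of a product of two primes *)

Lemma dvdn_prime_id p d : prime p -> (d %| p) = (d \in [:: 1; p]).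
Proof.
move=> p_pr; apply/idP/idP => [dp|]; last by rewrite !inE => /pred2P[]->.
by rewrite !inE; have /primeP[_] := p_pr; apply.
Qed.

Lemma perm_divisors_prime p : prime p -> perm_eq (divisors p) [:: 1; p].
Proof.
move=> p_pr; apply: uniq_perm; rewrite ?divisors_uniq //=.
  by rewrite inE neq_ltn prime_gt1.
by move=> d; rewrite -dvdn_divisors ?prime_gt0 // dvdn_prime_id.
Qed.

(** The case [p = q] is included; the list then repeats [p], hence an equality of membership
    only. *)
Lemma mem_divisors_semiprime p q : prime p -> prime q ->
  divisors (p * q) =i [:: 1; p; q; p * q].
Proof.
move=> p_pr q_pr d; rewrite -dvdn_divisors ?muln_gt0 ?prime_gt0 // !inE.
apply/idP/idP=> [|/or4P[]/eqP->]; try solve [exact: dvd1n | exact: dvdnn | exact: dvdn_mulr | exact: dvdn_mull].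
have [/dvdnP[e ->]|ndp] := boolP (p %| d).
  rewrite [e * p]mulnC dvdn_pmul2l ?prime_gt0 // dvdn_prime_id // !inE.
  by case/pred2P=> ->; rewrite ?muln1 eqxx ?orbT.
rewrite Gauss_dvdr ?dvdn_prime_id //; last by rewrite coprime_sym prime_coprime.
by rewrite !inE => /pred2P[]->; rewrite eqxx ?orbT.
Qed.

(** * Counting the generating pairs of a group *)

Section GeneratingPairs.

Variable gT : finGroupType.
Implicit Types (G H K : {group gT}) (u : gT * gT).

Definition generated_by u : {group gT} := <<[set u.1; u.2]>>%G.

(** A pair of [gT] generating [H] lies in [H], so the count is intrinsic to [H]: it is Hall's
    Eulerian function for pairs. *)
Definition generating_pairs H : nat := #|[set u | generated_by u == H]|.

Lemma generated_by_sub u G : (generated_by u \subset G) = (u \in setX G G).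
Proof. by rewrite gen_subG subUset !sub1set inE. Qed.

(** [B(G)] is the fibre graph of the map sending a pair to the subgroup it generates; the identity
    is the isomorphism. *)
Lemma star_forest_sgb G :
  star_forest [seq generating_pairs H | H in subgroups G] 'B(G)%sg.
Proof.
have sub_gen (v : pair_vertex G) : generated_by (val v) \in subgroups G.
  by rewrite inE generated_by_sub (valP v).
pose f (v : pair_vertex G) : subgroup_vertex G :=
  exist (fun H => is_true (H \in subgroups G)) _ (sub_gen v).
exists (pair_vertex G), (subgroup_vertex G), f; split.
  exists id; split=> [|[u|H] [u'|H'] //=]; first by exists id.
have fE v : fibre_size f v = generating_pairs (val v).
  rewrite /fibre_size /generating_pairs -(card_imset _ val_inj).
  apply: eq_card => u; rewrite [RHS]inE; apply/imsetP/eqP => [[w]|uH].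
    by rewrite inE => /eqP <- ->.
  have uG : u \in setX G G.
    by rewrite -generated_by_sub uH; have:= valP v; rewrite inE.
  by exists (exist (fun u => is_true (u \in setX G G)) u uG) => //; rewrite inE -val_eqE /= uH.
rewrite /image_mem (eq_map fE) (map_comp generating_pairs val) perm_map //.
apply: uniq_perm; rewrite ?enum_uniq ?(map_inj_uniq val_inj) ?enum_uniq // => H.
rewrite mem_enum; apply/mapP/idP => [[K _ ->]|HG]; first exact: valP.
by exists (exist (fun H => is_true (H \in subgroups G)) H HG); rewrite ?mem_enum.
Qed.

Lemma sum_generating_pairs H :
  \sum_(K in subgroups H) generating_pairs K = #|H| ^ 2.
Proof.
rewrite expnS expn1 -cardsX -sum1_card.
rewrite (partition_big generated_by (mem (subgroups H))) /=; last first.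
  by move=> u uH; rewrite inE generated_by_sub.
apply: eq_bigr => K; rewrite inE => sKH; rewrite /generating_pairs -sum1_card.
apply: eq_bigl => u; rewrite inE; case: eqP => [uK|]; rewrite ?andbF // andbT.
by rewrite -generated_by_sub uK.
Qed.

(** A cyclic group has exactly one subgroup of each order dividing its own, so sums over subgroups
    become sums over divisors. *)
Lemma card_subgroups_cyclic H : cyclic H ->
  perm_eq [seq #|gval K| | K in subgroups H] (divisors #|H|).
Proof.
move=> cH; apply: uniq_perm; rewrite ?divisors_uniq //.
  rewrite map_inj_in_uniq ?enum_uniq // => K L.
  rewrite !mem_enum !inE => sK sL eKL; apply/eqP.
  by rewrite -val_eqE /= (eq_subG_cyclic cH) // eKL.
move=> d; rewrite -dvdn_divisors ?cardG_gt0 //; apply/imageP/idP=> [[K]|dH].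
  by rewrite inE => sK ->; apply: cardSg.
case/cyclicP: cH dH => x eH; rewrite eH => dH.
have := cycle_sub_group dH; move/setP/(_ <[x ^+ (#[x]%g %/ d)]>%G).
rewrite inE set11 => /andP[sK /eqP oK]; exists <[x ^+ (#[x]%g %/ d)]>%G.
  by rewrite inE.
by rewrite oK.
Qed.

(** The term of [H] is isolated in [sum_generating_pairs]. The additive form avoids truncated
    subtraction. *)
Lemma generating_pairs_cyclic H (F : nat -> nat) : cyclic H ->
    (forall K, K \proper H -> generating_pairs K = F #|K|) ->
  generating_pairs H + \sum_(d <- divisors #|H| | d != #|H|) F d = #|H| ^ 2.
Proof.
move=> cH FE; rewrite -sum_generating_pairs (bigD1 H) ?inE ?subxx //=.
congr (_ + _); rewrite -(perm_big _ (card_subgroups_cyclic cH)) /=.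
rewrite big_map big_enum_cond; symmetry; apply: eq_big => K.
  apply: andb_id2l; rewrite inE => sK.
  by rewrite -val_eqE /= (eq_subG_cyclic cH).
rewrite inE => /andP[sK neK]; apply: FE.
by rewrite properEneq sK andbT.
Qed.

Lemma generating_pairs1 H : #|H| = 1 -> generating_pairs H = 1.
Proof.
move=> oH; have cH : cyclic H by rewrite (card1_trivg oH) cyclic1.
(* Any [F] would do, as a group of order 1 has no proper subgroup. *)
have := @generating_pairs_cyclic H id cH.
rewrite oH big_cons big_nil /= addn0; apply=> K /proper_card.
by rewrite oH ltnNge cardG_gt0.
Qed.

Lemma generating_pairs_prime H : prime #|H| -> generating_pairs H = #|H| ^ 2 - 1.
Proof.
move=> pH; have <- := @generating_pairs_cyclic H (fun=> 1) (prime_cyclic pH).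
  rewrite (perm_big _ (perm_divisors_prime pH)) !big_cons big_nil /=.
  by rewrite eqxx neq_ltn prime_gt1 // addnK.
move=> K pKH; apply: generating_pairs1; move: (cardSg (proper_sub pKH)).
rewrite (dvdn_prime_id _ pH) !inE; case/pred2P => // eKH.
by have := proper_card pKH; rewrite eKH ltnn.
Qed.

(** [K] is trivial or of prime order; the boolean, read as 0 or 1, merges the values 1 and
    [#|K| ^ 2 - 1]. *)
Lemma generating_pairs_proper_semiprime H K p q :
    prime p -> prime q -> #|H| = p * q -> K \proper H ->
  generating_pairs K = #|K| ^ 2 - (#|K| != 1).
Proof.
move=> p_pr q_pr oH pKH; have [oK1|K1 /=] := eqVneq #|K| 1.
  by rewrite generating_pairs1 // oK1.
apply: generating_pairs_prime.
have : #|K| \in divisors (p * q) by rewrite -oH -dvdn_divisors ?cardG_gt0 ?cardSg ?proper_sub.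
rewrite (mem_divisors_semiprime p_pr q_pr) !inE (negPf K1) /=.
case/or3P=> /eqP oK; rewrite oK //.
by have := proper_card pKH; rewrite oK oH ltnn.
Qed.

(** From [(p * q) ^ 2] the proper subgroups remove 1, [p ^ 2 - 1] and [q ^ 2 - 1], and the rest
    factors. *)
Lemma generating_pairs_cyclic_pq H p q :
    cyclic H -> prime p -> prime q -> p != q -> #|H| = p * q ->
  generating_pairs H = (p ^ 2 - 1) * (q ^ 2 - 1).
Proof.
move=> cH p_pr q_pr neq_pq oH; have p1 := prime_gt1 p_pr; have q1 := prime_gt1 q_pr.
have := @generating_pairs_cyclic H (fun d => d ^ 2 - (d != 1)) cH
  (fun K => generating_pairs_proper_semiprime p_pr q_pr oH).
have [np nq npq p_pq q_pq] :
    [/\ p != 1, q != 1, 1 != p * q, p != p * q & q != p * q].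
  by split; apply/eqP; nia.
rewrite oH (perm_big [:: 1; p; q; p * q]) /=; last first.
  by apply: uniq_perm; rewrite ?divisors_uniq //= ?inE ?negb_or ?neq_pq ?npq ?p_pq ?q_pq
    ?[1 == _]eq_sym ?np ?nq // => d; apply: mem_divisors_semiprime.
rewrite !big_cons big_nil eqxx /= !addn0.
rewrite npq p_pq q_pq np nq eqxx /= expnMn exp1n subn0.
have : 0 < p ^ 2 by rewrite expn_gt0 ltnW.
have : 0 < q ^ 2 by rewrite expn_gt0 ltnW.
(* Both squares become successors, which eliminates the truncated subtractions. *)
case: (p ^ 2) (q ^ 2) => [|P] [|R] // _ _; rewrite !subn1 /=; lia.
Qed.

Lemma generating_pairs_cyclic_pp H p :
    cyclic H -> prime p -> #|H| = p ^ 2 ->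
  generating_pairs H = p ^ 4 - p ^ 2.
Proof.
move=> cH p_pr; rewrite -mulnn => oH; have p1 := prime_gt1 p_pr.
have := @generating_pairs_cyclic H (fun d => d ^ 2 - (d != 1)) cH
  (fun K => generating_pairs_proper_semiprime p_pr p_pr oH).
have [np npp p_pp] : [/\ p != 1, 1 != p * p & p != p * p].
  by split; apply/eqP; nia.
rewrite oH (perm_big [:: 1; p; p * p]) /=; last first.
  apply: uniq_perm; rewrite ?divisors_uniq //= ?inE.
    by rewrite negb_or npp p_pp eq_sym np.
  by move=> d; rewrite mem_divisors_semiprime // !inE; case: (d == p); rewrite ?orbT.
rewrite !big_cons big_nil eqxx /= !addn0.
rewrite npp p_pp np eqxx /= !expnS !expn0 !muln1 /=; nia.
Qed.

Lemma generating_pairs_subgroups_cyclic H (F : nat -> nat) s : cyclic H ->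
    (forall K, K \subset H -> generating_pairs K = F #|K|) ->
    perm_eq (divisors #|H|) s ->
  perm_eq [seq generating_pairs K | K in subgroups H] (map F s).
Proof.
move=> cH FE Hs; rewrite -(permPr (perm_map F Hs)).
rewrite -(permPr (perm_map F (card_subgroups_cyclic cH))) /image_mem -map_comp.
suff /eq_in_map-> : {in enum (subgroups H), generating_pairs =1 F \o (fun K => #|K|)} by [].
by move=> K; rewrite mem_enum inE => /FE.
Qed.

End GeneratingPairs.

Arguments generating_pairs {gT} H.

(** * Subgroups of the dicyclic group *)

Section Dicyclic.

Local Open Scope group_scope.

Variables (gT : finGroupType) (p : nat).
Hypothesis p_pr : prime p.

Section Generators.

Variables (Q : {group gT}) (a b : gT).
Hypotheses (defQ : <[a]> <*> <[b]> = Q) (a2p : a ^+ (2 * p) = 1).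
Hypotheses (b2 : b ^+ 2 = a ^+ p) (ba : b * a * b^-1 = a^-1).

(** Since [b] normalises [<[a]>], every element is a power of [a] times a power of [b], and even
    powers of [b] are powers of [a]. *)
Lemma dicyclic_coset x : x \in Q -> exists2 y, y \in <[a]> & (x == y) || (x == y * b).
Proof.
have nab : <[b]> \subset 'N(<[a]>).
  by rewrite -cycleV norms_cycle conjgE invgK mulgA ba groupV cycle_id.
rewrite -defQ norm_joinEr // => /mulsgP[y _ ya /cycleP[k ->] ->].
have bk : b ^+ k = a ^+ (p * (k %/ 2)) * b ^+ (k %% 2).
  by rewrite expgM -b2 -expgM -expgD mulnC -divn_eq.
exists (y * a ^+ (p * (k %/ 2))); first by rewrite groupM ?mem_cycle.
rewrite bk mulgA modn2; case: odd; first by rewrite expg1 eqxx orbT.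
by rewrite expg0 mulg1 eqxx.
Qed.

Lemma dicyclic_sqr x : x \in Q :\: <[a]> -> x ^+ 2 = a ^+ p.
Proof.
case/setDP=> /dicyclic_coset[y ya /orP[]/eqP->]; first by rewrite ya.
case/cycleP: ya => i ya _; rewrite {y}ya.
have bconj z : b * z * b^-1 = z ^ b^-1 by rewrite conjgE invgK mulgA.
have bai : b * a ^+ i * b^-1 = a ^- i by rewrite bconj conjXg -bconj ba expgVn.
(* The square of [a ^+ i * b] is rearranged so that the conjugate [a ^- i] cancels [a ^+ i]. *)
transitivity (a ^+ i * (b * a ^+ i * b^-1) * b ^+ 2).
  by rewrite !expgS !expg0 !mulg1 !mulgA mulgKV.
by rewrite bai mulgV mul1g b2.
Qed.

Lemma card_dicyclic_leq : #|Q| <= 2 * #[a].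
Proof.
have sub : Q \subset <[a]> :|: <[a]> :* b.
  apply/subsetP=> x /dicyclic_coset[y ya /orP[]/eqP->]; rewrite inE ?ya //.
  by apply/orP; right; rewrite mem_rcoset mulgK.
apply: leq_trans (subset_leq_card sub) _.
by rewrite (leq_trans (leq_card_setU _ _)) // card_rcoset mul2n addnn.
Qed.

Hypothesis oQ : #|Q| = (4 * p)%N.

(** The bounds [4 * p <= 2 * #[a]] and [#[a] <= 2 * p] leave no slack. *)
Lemma order_dicyclic_gen : #[a] = (2 * p)%N.
Proof.
have := card_dicyclic_leq; rewrite oQ => le4p.
have le2p : #[a] <= 2 * p.
  by rewrite dvdn_leq ?muln_gt0 ?prime_gt0 // order_dvdn a2p.
by apply/eqP; rewrite eqn_leq le2p /= -(leq_pmul2l (ltn0Sn 1)) mulnA.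
Qed.

Lemma sub_dicyclic_gen : <[a]> \subset Q.
Proof. by rewrite -defQ joing_subl. Qed.

Lemma order_dicyclic_sqr : #[a ^+ p] = 2.
Proof.
by rewrite orderXdiv order_dicyclic_gen ?dvdn_mull // mulnK // prime_gt0.
Qed.

(** The square of [x] is [a ^+ p], of order 2. *)
Lemma order_dicyclic_coset x : x \in Q :\: <[a]> -> #[x] = 4.
Proof.
move=> xQ; have x2 := dicyclic_sqr xQ.
have x2n1 : x ^+ 2 != 1 by rewrite x2 -order_gt1 order_dicyclic_sqr.
have : #[x] %| 2 * 2 by rewrite order_dvdn expgM x2 -expgM mulnC a2p.
rewrite dvdn_divisors // !inE.
by case/or3P=> /eqP // ox; case/eqP: x2n1; apply/eqP; rewrite -order_dvdn ox.
Qed.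

Definition outer_subgroups : {set {group gT}} :=
  [set K in subgroups Q | ~~ (K \subset <[a]>) & K != Q].

(** [K] contains an element of order 4, so its order is [4 * k] with [k] dividing [p]; [k = p] would
    give [K = Q]. *)
Lemma card_outer_subgroup K : K \in outer_subgroups -> #|K| = 4.
Proof.
rewrite !inE => /and3P[sKQ /subsetPn[x xK xA] neKQ].
have ox : #[x] = 4 by apply: order_dicyclic_coset; rewrite inE xA (subsetP sKQ).
have /dvdnP[k oK] : 4 %| #|K| by rewrite -ox order_dvdG.
have := cardSg sKQ; rewrite oK oQ mulnC dvdn_pmul2l // dvdn_prime_id // !inE.
case/pred2P=> k_eq; first by rewrite k_eq.
case/eqP: neKQ; apply/val_inj/eqP; rewrite /= eqEcard sKQ oQ oK k_eq mulnC.
exact: leqnn.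
Qed.

(** An element of [K] outside [<[a]>] has order 4, that of [K], so it generates [K]. *)
Lemma outer_subgroup_cycle K x :
  K \in outer_subgroups -> (x \in K :\: <[a]>) = (x \in Q :\: <[a]>) && (<[x]>%G == K).
Proof.
move=> KS; have oK := card_outer_subgroup KS.
have sKQ : K \subset Q by move: KS; rewrite !inE => /and3P[].
rewrite !inE; case xA: (x \in <[a]>) => //=.
apply/idP/andP=> [xK|[_ /eqP<-]]; last exact: cycle_id.
have xQ := subsetP sKQ x xK; split=> //; rewrite -val_eqE /= eqEcard cycle_subG xK oK.
by rewrite -orderE order_dicyclic_coset // inE xA.
Qed.

Lemma cycle_outer_subgroup x : x \in Q :\: <[a]> -> <[x]>%G \in outer_subgroups.
Proof.
move=> xQA; have ox := order_dicyclic_coset xQA.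
case/setDP: xQA => xQ xA; rewrite !inE !cycle_subG xQ xA.
apply/eqP=> /(congr1 (fun K : {group gT} => #|K|)); rewrite /= -orderE ox oQ.
by have := prime_gt1 p_pr; lia.
Qed.

(** [K :&: <[a]>] contains the involution [a ^+ p] and is not all of [K], so it has order 2. *)
Lemma card_outer_subgroupD K : K \in outer_subgroups -> #|K :\: <[a]>| = 2.
Proof.
move=> KS; have oK := card_outer_subgroup KS; rewrite cardsD oK.
have /subsetPn[x xK xA] : ~~ (K \subset <[a]>) by move: KS; rewrite !inE => /and3P[].
have xQA : x \in Q :\: <[a]>.
  by have := outer_subgroup_cycle x KS; rewrite inE xA xK => /esym/andP[].
have : #|K :&: <[a]>| \in divisors 4 by rewrite -dvdn_divisors // -oK cardSg ?subsetIl.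
have apK : a ^+ p \in K :&: <[a]>.
  by rewrite inE mem_cycle -(dicyclic_sqr xQA) groupX.
have := order_dvdG apK; rewrite order_dicyclic_sqr.
rewrite !inE => + /or3P[]/eqP oI; rewrite oI //.
move=> _; case/negP: xA; apply: (subsetP _ x xK); apply/setIidPl/eqP.
by rewrite eqEcard subsetIl oI oK.
Qed.

(** The [2 * p] elements outside [<[a]>], sorted by the cyclic subgroup they generate, fall into
    classes of size 2. *)
Lemma card_outer_subgroups : #|outer_subgroups| = p.
Proof.
have oD : #|Q :\: <[a]>| = (2 * p)%N.
  by rewrite cardsD (setIidPr sub_dicyclic_gen) -orderE order_dicyclic_gen oQ; lia.
apply/eqP; rewrite -(eqn_pmul2l (ltn0Sn 1)) -oD; apply/eqP.
rewrite -[RHS]sum1_card (partition_big (fun x => <[x]>%G) (mem outer_subgroups)) /=; last first.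
  by move=> x; apply: cycle_outer_subgroup.
rewrite mulnC -sum_nat_const; apply: eq_bigr => K KS.
rewrite -(card_outer_subgroupD KS) -sum1_card; apply: eq_bigl => x.
exact: outer_subgroup_cycle.
Qed.

Lemma generating_pairs_outer_subgroup K :
  K \in outer_subgroups -> generating_pairs K = 12.
Proof.
move=> KS; have oK := card_outer_subgroup KS.
have /subsetPn[x xK xA] : ~~ (K \subset <[a]>) by move: KS; rewrite !inE => /and3P[].
have /andP[_ /eqP eK] : (x \in Q :\: <[a]>) && (<[x]>%G == K).
  by rewrite -outer_subgroup_cycle // inE xA.
have cK : cyclic K by rewrite -eK cycle_cyclic.
exact: (@generating_pairs_cyclic_pp _ _ 2 cK isT oK).
Qed.

Lemma generating_pairs_dicyclic :
  perm_eq [seq generating_pairs K | K in subgroups Q]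
    ([seq generating_pairs K | K in subgroups <[a]>] ++ nseq p 12
     ++ [:: 12 * p ^ 2 - 12 * p])%N.
Proof.
have ngA : ~~ (Q \subset <[a]>).
  apply/negP=> /subset_leq_card; rewrite -orderE oQ order_dicyclic_gen.
  by have := prime_gt0 p_pr; lia.
have enumQ : perm_eq (enum (subgroups Q))
    (enum (subgroups <[a]>) ++ enum outer_subgroups ++ [:: Q]).
  apply: uniq_perm; rewrite ?enum_uniq //.
    rewrite !cat_uniq !enum_uniq /= !orbF mem_enum !inE eqxx !andbF andbT /=.
    rewrite has_cat /= orbF mem_enum inE (negPf ngA) orbF.
    by rewrite andbT; apply/hasPn=> K; rewrite !mem_enum !inE => /and3P[].
  move=> K; rewrite !mem_cat !mem_enum !inE; have [->|neKQ] := eqVneq K Q.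
    by rewrite subxx !orbT.
  rewrite orbF andbT; case sKA: (K \subset <[a]>) => /=.
    by rewrite (subset_trans sKA) ?sub_dicyclic_gen.
  by rewrite andbT.
have sumQ := sum_generating_pairs Q; have sumA := sum_generating_pairs <[a]>.
have outerE : [seq generating_pairs K | K <- enum outer_subgroups] = nseq p 12%N.
  rewrite -card_outer_subgroups cardE -(size_map generating_pairs).
  apply/all_pred1P/allP=> _ /mapP[K + ->]; rewrite mem_enum => KS.
  by rewrite /= generating_pairs_outer_subgroup.
rewrite /image_mem (permPl (perm_map _ enumQ)) !map_cat outerE /=.
suff -> : generating_pairs Q = (12 * p ^ 2 - 12 * p)%N by [].
(* The subgroups of [<[a]>] contribute [(2 * p) ^ 2] in total, leaving
   [16 * p ^ 2 - 4 * p ^ 2 - 12 * p] pairs for [Q]; this covers every prime [p]. *)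
have := sumQ; rewrite -big_enum (perm_big _ enumQ) !big_cat /= big_seq1 big_enum sumA.
rewrite big_enum (eq_bigr _ generating_pairs_outer_subgroup) sum_nat_const.
rewrite card_outer_subgroups oQ -orderE order_dicyclic_gen !expnMn; lia.
Qed.

End Generators.

End Dicyclic.

(** * Generating pairs inside the cyclic subgroup generated by [a] *)

Lemma generating_pairs_cyclic_2p (gT : finGroupType) p (A : {group gT}) :
    prime p -> 2 < p -> cyclic A -> #|A| = 2 * p ->
  perm_eq [seq generating_pairs K | K in subgroups A]
    [:: 1; 3; p ^ 2 - 1; 3 * p ^ 2 - 3].
Proof.
move=> p_pr p2 cA oA; have neq2p : 2 != p by rewrite neq_ltn p2.
(* The top value is [(2 ^ 2 - 1) * (p ^ 2 - 1)]; smaller orders are 1 or prime. *)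
pose F d := if d == 2 * p then 3 * p ^ 2 - 3 else d ^ 2 - (d != 1).
have /permPl-> : perm_eq [seq generating_pairs K | K in subgroups A]
    (map F [:: 1; 2; p; 2 * p]).
  apply: generating_pairs_subgroups_cyclic => // [K sKA|].
    have [/eqP oK|oK] := boolP (#|K| == 2 * p); rewrite /F.
      have -> : K = A by apply/val_inj/eqP; rewrite eqEcard sKA oA oK leqnn.
      rewrite oA eqxx (@generating_pairs_cyclic_pq _ _ 2 p) //.
      by rewrite mulnBr muln1.
    rewrite (negPf oK) (@generating_pairs_proper_semiprime _ A _ 2 p) //.
    by rewrite properEcard sKA ltn_neqAle subset_leq_card // oA oK.
  rewrite oA; apply: uniq_perm; rewrite ?divisors_uniq //=.
    by rewrite !inE; lia.
  exact: mem_divisors_semiprime.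
rewrite /F /= eqxx.
have -> : (1 == 2 * p) = false by lia.
have -> : (2 == 2 * p) = false by lia.
have -> : (p == 2 * p) = false by lia.
by have -> : p != 1 by lia.
Qed.

Lemma generating_pairs_cyclic_4 (gT : finGroupType) (A : {group gT}) :
    cyclic A -> #|A| = 4 ->
  perm_eq [seq generating_pairs K | K in subgroups A] [:: 1; 3; 12].
Proof.
move=> cA oA; pose F d := if d == 4 then 12 else d ^ 2 - (d != 1).
rewrite -[[:: 1; 3; 12]]/(map F [:: 1; 2; 4]).
apply: generating_pairs_subgroups_cyclic => // [K sKA|]; last by rewrite oA.
have [/eqP oK|oK] := boolP (#|K| == 4); rewrite /F.
  have -> : K = A by apply/val_inj/eqP; rewrite eqEcard sKA oA oK leqnn.
  by rewrite oA (@generating_pairs_cyclic_pp _ _ 2).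
rewrite (negPf oK) (@generating_pairs_proper_semiprime _ A _ 2 2) //.
by rewrite properEcard sKA ltn_neqAle subset_leq_card // oA oK.
Qed.

(** * The order of the group given by the presentation *)

(** Here [x ^ y] is [y^-1 * x * y], whereas the presentation conjugates the other way. *)
Lemma conjgV_inv (gT : finGroupType) (x y : gT) :
  (x ^ y = x^-1 -> y * x * y^-1 = x^-1)%g.
Proof.
move=> xy; apply: invg_inj.
by rewrite !invMg !invgK -xy conjgE !mulgA mulgV mul1g mulgK.
Qed.

(* The lower bound on the order of Q needs a model of the presentation: 'Q_8 if
   p = 2; otherwise the extension <x> ><| <y> with x ^+ p = 1, y ^+ 4 = 1 and
   x ^ y = x^-1, where x * y ^+ 2 and y satisfy the relations. *)
Lemma card_dicyclic_dvdn (gT : finGroupType) (Q : {group gT}) p :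
    prime p ->
    (Q \isog Grp (a : b : a ^+ (2 * p)%N = 1, b ^+ 2 = a ^+ p,
                          b * a * b^-1 = a^-1))%g ->
  4 * p %| #|Q|.
Proof.
move=> p_pr isoQ; have p1 := prime_gt1 p_pr.
have [p_eq2|p_odd] := even_prime p_pr.
  rewrite p_eq2 in isoQ *.
  have o8 : #|[set: 'Q_(2 ^ 3)]| = 8 := @card_quaternion 3 isT.
  (* The order of a homomorphic image divides [#|Q|], and by [isoQ] an image is any group generated
     by a pair satisfying the relations. *)
  rewrite -[4 * 2]o8; apply: card_homg; rewrite isoQ.
  have := isoGrp_hom (@Grp_quaternion 3 isT).
  case/existsP=> -[x y] /= /eqP[defG x4 y2 /conjgV_inv xy].
  by apply/existsP; exists (x, y); rewrite /= !xpair_eqE defG x4 y2 xy !eqxx.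
have := isoGrp_hom (@Grp_ext_dihedral p p1 4 isT isT).
have := @card_ext_dihedral p p1 4 isT isT.
set E := [set: _] => oE /existsP[[x y]] /= /eqP[defE xp y4 xy].
have -> : 4 * p = #|E| by rewrite oE -mul2n mulnA.
apply: card_homg; rewrite isoQ; apply/existsP; exists (x * y ^+ 2, y)%g.
have cxy : commute x (y ^+ 2)%g.
  by apply/commgP/conjg_fixP; rewrite expgS expg1 conjgM xy conjVg xy invgK.
(* Powers of [y ^+ 2] depend only on parity, so with [p] odd the [p]-th power of [x * y ^+ 2] is
   [y ^+ 2]. *)
have y2n n : (y ^+ 2 ^+ n = y ^+ 2 ^+ (odd n))%g.
  rewrite -{1}(odd_double_half n) expgD -mul2n expgM -[X in (_ * X ^+ _)%g]expgM.
  by rewrite y4 expg1n mulg1.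
have ap : ((x * y ^+ 2) ^+ p = y ^+ 2)%g by rewrite expgMn // xp mul1g y2n p_odd.
have yay : (y * (x * y ^+ 2) * y^-1 = (x * y ^+ 2)^-1)%g.
  have y2V : ((y ^+ 2)^-1 = y ^+ 2)%g by apply/eqP; rewrite eq_invg_mul -expgD y4.
  have cx : commute (y ^+ 2)%g x^-1%g by apply/commuteV/commute_sym.
  transitivity (y * x * y^-1 * y ^+ 2)%g.
    by rewrite expgS expg1 !mulgA mulgK mulgKV.
  by rewrite (conjgV_inv xy) invMg y2V cx.
rewrite /= !xpair_eqE ap yay mulnC expgM ap -expgM y4 !eqxx !andbT.
rewrite -defE eqEsubset !join_subG !cycle_subG /=.
have yJ z : (y \in <[z]> <*> <[y]>)%g by rewrite mem_gen // inE cycle_id orbT.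
have zJ z : (z \in <[z]> <*> <[y]>)%g by rewrite mem_gen // inE cycle_id.
rewrite !yJ !andbT groupM ?groupX //=.
(* [x] is recovered as [(x * y ^+ 2) * y ^- 2], so the new pair still generates the group. *)
rewrite -{1}[x](mulgK (y ^+ 2)%g); apply: groupM; first exact: zJ.
by rewrite groupV groupX ?yJ.
Qed.

Theorem theorem4p3 (p : nat) (gT : finGroupType) (Q : {group gT}) :
  prime p ->
  (Q \isog Grp (a : b : a ^+ (2 * p)%N = 1, b ^+ 2 = a ^+ p, b * a * b^-1 = a^-1))%g ->
  (p = 2 ->
     'B(Q) ≅ 'K_2 ⊔ 'K_(1, 3) ⊔ 3 ⋅ 'K_(1, 12) ⊔ 'K_(1, 24)) /\
  (3 <= p ->
     'B(Q) ≅ 'K_2 ⊔ 'K_(1, 3) ⊔ p ⋅ 'K_(1, 12) ⊔ 'K_(1, p ^ 2 - 1)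
             ⊔ 'K_(1, 3 * p ^ 2 - 3) ⊔ 'K_(1, 12 * p ^ 2 - 12 * p)).
Proof.
move=> p_pr isoQ; have dvQ := card_dicyclic_dvdn p_pr isoQ.
have /existsP[[a b] /= /eqP[defQ a2p b2 ba]] := isoGrp_hom isoQ.
(* The model gives the lower bound, the relations the upper one. *)
have oQ : #|Q| = 4 * p.
  apply/eqP; rewrite eqn_leq; apply/andP; split; last exact: dvdn_leq.
  apply: leq_trans (card_dicyclic_leq defQ b2 ba) _.
  rewrite -[4]/(2 * 2) -mulnA leq_pmul2l //.
  by rewrite dvdn_leq ?muln_gt0 ?prime_gt0 // order_dvdn a2p.
have oa := order_dicyclic_gen p_pr defQ a2p b2 ba oQ.
have gpQ := generating_pairs_dicyclic p_pr defQ a2p b2 ba oQ.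
have flatten_nseq1 m n : flatten (nseq m [:: n]) = nseq m n by elim: m => //= m ->.
have cA := cycle_cyclic a.
split=> [p_eq2 | p_gt2].
  rewrite p_eq2 in oa gpQ; apply: star_forest_iso (star_forest_sgb Q) _ _.
    do !apply: star_forest_disjoint_union.
    - exact: star_forest_K2.
    - exact: star_forest_star.
    - exact/star_forest_copies/star_forest_star.
    exact: star_forest_star.
  apply: perm_trans gpQ _.
  (* For [p = 2] the group [<[a]>] is itself cyclic of order 4 and supplies the third star with 12
     leaves. *)
  by rewrite (permPl (perm_cat (generating_pairs_cyclic_4 cA oa) (perm_refl _))).
apply: star_forest_iso (star_forest_sgb Q) _ _.
  do !apply: star_forest_disjoint_union.
  - exact: star_forest_K2.
  - exact: star_forest_star.
  - exact/star_forest_copies/star_forest_star.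
  - exact: star_forest_star.
  - exact: star_forest_star.
  exact: star_forest_star.
apply: perm_trans gpQ _.
rewrite (permPl (perm_cat (generating_pairs_cyclic_2p p_pr p_gt2 cA oa) (perm_refl _))).
(* Past 1 and 3, the two lists differ by swapping the block of 12s with the two counts from
   [<[a]>]. *)
rewrite flatten_nseq1 -!catA /= !perm_cons.
exact: (permEl (perm_catCA [:: _; _] _ [:: _])).
Qed.
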